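(* Let $L$ be a triangulation of the $k$-dimensional simplex such that the only vertices of $L$ on the boundary of the simplex are the original vertices of the simplex, and let $j\in\{2,\ldots,k+1\}$. For all $n\geq 0$, the generalized Tchebyshev polynomials of the $j$th kind $U^{L,j}_n(x)$ have the following properties: (1) $U^{L,j}_n(x)$ is a polynomial of degree $n$; (2) $(-1)^n U^{L,j}_n(-x)=U^{L,j}_n(x)$; (3) all real roots of $U^{L,j}_n(x)$ belong to the interval $[-1,1]$.
   Context: Simplicial complexes are finite abstract simplicial complexes, containing the empty face; $k\geq 1$. The link of a face $\sigma$ of $K$ is $\mathrm{link}_K(\sigma)=\{\tau\in K: \sigma\cap\tau=\emptyset,\ \sigma\cup\tau\in K\}$. $f_i(K)$ is the number of $i$-dimensional faces of $K$. The $F$-polynomial of $K$ is $F(K,x)=\sum_{j=0}^{\dim K+1} f_{j-1}(K)\left(\frac{x-1}{2}\right)^j$. $\partial(L)$ denotes the subcomplex of boundary faces of $L$, which is the boundary complex of the original $k$-simplex; $V(\cdot)$ denotes vertex set. A simplicial complex $K'$ is a generalized Tchebyshev triangulation of $K$ induced by $L$ if there is an ordered list $\sigma_1,\ldots,\sigma_m$ of the $k$-dimensional faces of $K$, listing each exactly once, bijections $\phi_{\sigma_i}:V(\partial(L))\to\sigma_i$, and simplicial complexes $K_0=K,K_1,\ldots,K_m=K'$ such that for each $i\geq 1$ the complex $K_i$ is obtained from $K_{i-1}$ as follows: take an isomorphic copy $L_i$ of $L$ in which each boundary vertex $w\in V(\partial(L))$ is identified with $\phi_{\sigma_i}(w)$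 and the interior vertices are new vertices, and replace the family of faces $\{\sigma_i\cup\tau:\tau\in\mathrm{link}_{K_{i-1}}(\sigma_i)\}$ by the family $\{\sigma'\cup\tau:\sigma'\in L_i,\ \tau\in\mathrm{link}_{K_{i-1}}(\sigma_i)\}$. For $j\in\{2,\ldots,k+1\}$ there is a unique linear map $U^{L,j}:\mathbb{R}[x]\to\mathbb{R}[x]$ satisfying $U^{L,j}(x^n)=0$ for $n\leq j-2$ and such that for every simplicial complex $K$ and every generalized Tchebyshev triangulation $K'$ of $K$ induced by $L$, $$U^{L,j}(F(K,x))=\sum_{\sigma\in K,\ |\sigma|=j-1}F(\mathrm{link}_{K'}(\sigma),x).$$ The generalized Tchebyshev polynomial of the $j$th kind is $U^{L,j}_n(x)=2^{1-j}\,(j-1)!\,U^{L,j}(x^{n+j-1})$. *)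

(* Defs.v *)
From mathcomp Require Import all_boot all_order all_algebra.
From mathcomp Require Import boolp classical_sets reals.

Set Implicit Arguments.
Unset Strict Implicit.
Unset Printing Implicit Defensive.

Import Order.TTheory GRing.Theory Num.Theory.
Local Open Scope ring_scope.

Section Complexes.
Variable T : finType.
Implicit Types (K : {set {set T}}) (s : {set T}).

Definition simplicial_complex K : Prop :=
  finset.set0 \in K /\ (forall s t : {set T}, s \in K -> t \subset s -> t \in K).

(* Points of T need not be vertices of K: T only supplies vertex names. *)
Definition vertices K : {set T} := [set v | [set v] \in K]%SET.

Definition link K s : {set {set T}} :=
  [set t in K | [disjoint s & t] && (s :|: t \in K)]%SET.

(* Indexed by cardinality: face_number K i is f_(i-1)(K). *)
Definition face_number K (i : nat) : nat := #|[set s in K | #|s| == i]%SET|.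

(* dim K + 1 *)
Definition card_bound K : nat := (\max_(s in K) #|s|)%N.

Definition Fpoly (R : realType) K : {poly R} :=
  \sum_(i < (card_bound K).+1)
     (face_number K i)%:R *: (2^-1 *: ('X - 1)) ^+ i.

End Complexes.

Section Triangulations.
Variables (R : realType) (k : nat) (W : finType).
Implicit Types (L : {set {set W}}) (p : W -> 'rV[R]_k.+1) (s : {set W}).

Definition std_simplex : set 'rV[R]_k.+1 :=
  [set x | (forall i, 0 <= x 0 i) /\ \sum_i x 0 i = 1]%classic.

Definition std_boundary : set 'rV[R]_k.+1 :=
  [set x | std_simplex x /\ exists i, x 0 i = 0]%classic.

Definition convex_hull p s : set 'rV[R]_k.+1 :=
  [set x | exists a : W -> R,
     [/\ forall w, 0 <= a w, \sum_(w in s) a w = 1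
       & x = \sum_(w in s) a w *: p w]]%classic.

Definition affinely_independent p s : Prop :=
  forall a : W -> R,
    \sum_(w in s) a w = 0 -> \sum_(w in s) a w *: p w = 0 ->
    forall w, w \in s -> a w = 0.

(* L, with the vertex w placed at the point p w, is a geometric simplicial
   complex whose union is the standard k-simplex. *)
Definition triangulation L p : Prop :=
  [/\ simplicial_complex L,
      forall s, s \in L -> affinely_independent p s,
      forall s t, s \in L -> t \in L ->
        (convex_hull p s `&` convex_hull p t)%classic
          = convex_hull p (s :&: t)%SET
    & (\bigcup_(s in [set` L]) convex_hull p s)%classic = std_simplex].

(* The vertices of std_simplex are the unit vectors delta_mx 0 i. *)
Definition no_new_boundary_vertices L p : Prop :=
  forall w, w \in vertices L ->
    std_boundary (p w) -> exists i : 'I_k.+1, p w = delta_mx 0 i.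

Definition boundary L p : {set {set W}} :=
  [set s in L | `[< (convex_hull p s `<=` std_boundary)%classic >]]%SET.

End Triangulations.

Section TchebyshevTriangulations.
Variables (W T : finType).
Implicit Types (L bL : {set {set W}}) (K : {set {set T}}) (s : {set T}).

(* c carries L onto the copy glued into s: its restriction to the boundary
   vertices is the bijection onto s, and interior vertices become new. *)
Definition gluing_map L bL K s (c : W -> T) : Prop :=
  [/\ {in vertices L &, injective c},
      [set c w | w in vertices bL]%SET = s
    & forall w, w \in vertices L -> w \notin vertices bL ->
        c w \notin vertices K].

Definition replace_face L K s (c : W -> T) : {set {set T}} :=
  ((K :\: [set s :|: t | t : {set T} in link K s]) :|:
   [set (c @: s') :|: t | s' : {set W} in L, t : {set T} in link K s])%SET.

Fixpoint replace_faces L bL K (r : seq {set T}) (K' : {set {set T}}) : Prop :=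
  if r is s :: r' then
    exists c : W -> T, gluing_map L bL K s c /\
      replace_faces L bL (replace_face L K s c) r' K'
  else K' = K.

(* bL is meant to be the boundary complex of L; k-dimensional faces have
   k + 1 elements. *)
Definition tchebyshev_triangulation (k : nat) L bL K (K' : {set {set T}}) :
    Prop :=
  exists r : seq {set T},
    [/\ uniq r, (forall s, (s \in r) = (s \in K) && (#|s| == k.+1))
      & replace_faces L bL K r K'].

End TchebyshevTriangulations.

(* The properties characterizing the linear map U^{L,j}. *)
Definition tchebyshev_map (R : realType) (k : nat) (W : finType)
    (L : {set {set W}}) (p : W -> 'rV[R]_k.+1) (j : nat)
    (U : {linear {poly R} -> {poly R}}) : Prop :=
  (forall n : nat, (n <= j - 2)%N -> U 'X^n = 0) /\
  (forall (T : finType) (K K' : {set {set T}}),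
     simplicial_complex K ->
     tchebyshev_triangulation k L (boundary L p) K K' ->
     U (Fpoly R K) = \sum_(s in K | #|s| == (j - 1)%N) Fpoly R (link K' s)).

(* U_n^{L,j}, when U is the map U^{L,j} *)
Definition tchebyshev_poly (R : realType) (j : nat)
    (U : {linear {poly R} -> {poly R}}) (n : nat) : {poly R} :=
  (((j - 1)`!)%:R / 2 ^+ (j - 1)) *: U 'X^(n + j - 1).

(* Main.v *)
(** Applied to the boundary complex K of the m-dimensional cross-polytope, with
    m = n + j - 1, the defining property of U reads
    [U 'X^m = sum_s F(link_K'(s))], the sum being over the (j-1)-element faces
    [s] of K, because F(K) = x^m.  The orthants form a complete simplicial fan
    over K, and gluing in geometric copies of L subdivides it, so K' also
    carries a complete simplicial fan.

    In such a fan pick a generic vector v.  Every face u is the source of a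
    unique facet r entered from u in the direction v, and the faces u attached
    to a given r form the Boolean interval between the negative part of v in r
    and r itself.  Hence, writing P and N for the vertices of r with positive
    and negative coordinates of v, the sum of t^|u \ s| over u >= s equals the
    sum over facets r >= s of t^|N \ s| (1+t)^|P \ s|.  Exchanging v and -v
    exchanges P and N, which gives the symmetry t <-> -1-t, that is x <-> -x
    for t = (x-1)/2.  Nonnegativity of the coefficients in t excludes roots
    x > 1, and the symmetry excludes roots x < -1. *)

Require Import Defs.
From mathcomp Require Import boolp classical_sets reals.
From mathcomp Require Import all_boot all_order all_algebra.
From mathcomp Require Import ring lra zify.

Import Order.TTheory GRing.Theory Num.Theory.
Local Open Scope ring_scope.

Set Implicit Arguments.
Unset Strict Implicit.
Unset Printing Implicit Defensive.

(** * Complete simplicial fans *)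

(** Expand a product of sums [F x + G x] over all [x]: each set [u] takes the weight [F] on its
    elements and [G] elsewhere. A weight is zero exactly where it must exclude the sets [u] missing
    from the left-hand side. *)
Lemma sum_powers_between (A : comNzRingType) (T : finType) (P : pred T)
    (s r : {set T}) (t : A) : s \subset r ->
  \sum_(u : {set T} | [&& s \subset u, u \subset r
                        & [forall x in r :\: u, P x]]) t ^+ #|u :\: s|
    = \prod_(x in r :\: s) (if P x then 1 + t else t).
Proof.
move=> sr.
pose F x := if x \in s then 1 else if x \in r then t else 0.
pose G x := if x \in s then 0 else if (x \in r) && ~~ P x then 0 else 1 : A.
rewrite [RHS]big_mkcond /=.
rewrite (eq_bigr (fun x => F x + G x)); last first.
  move=> x _; rewrite /F /G !inE.
  case: (x \in s) (subsetP sr x) => [/(_ isT) -> /=|_ /=]; first by rewrite addr0.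
  by case: (x \in r); case: (P x) => /=; rewrite ?add0r ?addr0 1?addrC.
rewrite bigA_distr [RHS]big_mkcond /= [LHS]big_mkcond /=; apply: eq_bigr => u _.
case: ifPn => [/and3P[su ur /forall_inP uP]|].
  rewrite -prodr_const [LHS]big_mkcond /=; apply: eq_bigr => x _; rewrite /F /G !inE.
  have := subsetP su x; have := subsetP ur x; have := uP x; rewrite !inE.
  by case: (x \in u); case: (x \in s); case: (x \in r) => //=;
    case: (P x) => // h1 h2 h3; try (by case: (h1 isT)); try (by case: (h2 isT));
    case: (h3 isT).
rewrite !negb_and => h; symmetry.
have [x Hx] : exists x, (if x \in u then F x else G x) == 0.
  case/or3P: h.
  - by case/subsetPn => x xs xu; exists x; rewrite (negPf xu) /G xs.
  - case/subsetPn => x xu xr; exists x; rewrite xu /F (negPf xr).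
    by case: ifP => // xs; rewrite (subsetP sr _ xs) in xr.
  - rewrite negb_forall_in => /existsP[x]; rewrite !inE => /andP[/andP[xu xr] px].
    by exists x; rewrite (negPf xu) /G xr px; case: ifP.
by rewrite (bigD1 x) //= (eqP Hx) mul0r.
Qed.

Section Fans.
Variables (R : archiRealFieldType) (m : nat) (T : finType).
Implicit Types (K : {set {set T}}) (q : T -> 'rV[R]_m) (a c : T -> R).

Definition supp a : {set T} := [set x | a x != 0].

Definition in_cone K a : Prop := (forall x, 0 <= a x) /\ supp a \in K.

(* The cones spanned by [q @: s], for [s] in [K], form a complete simplicial
   fan: every vector has exactly one nonnegative combination with support
   in [K]. *)
Definition complete_fan K q : Prop :=
  [/\ simplicial_complex K,
      forall y, exists2 a, in_cone K a & \sum_x a x *: q x = y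
    & forall a b, in_cone K a -> in_cone K b ->
        \sum_x a x *: q x = \sum_x b x *: q x -> a =1 b].

Lemma sum_supp q a (s : {set T}) : supp a \subset s ->
  \sum_x a x *: q x = \sum_(x in s) a x *: q x.
Proof.
move=> /subsetP as_; rewrite [RHS]big_mkcond /=; apply: eq_bigr => x _.
by case: ifPn => // xs; case: (eqVneq (a x) 0) => [->|ax];
  rewrite ?scale0r //; case/negP: xs; apply: as_; rewrite inE.
Qed.

(** A linear relation on [r] would yield two combinations of the same vector, with coefficients [M]
    and [M + c], both with support exactly [r]. *)
Lemma fan_free K q (r : {set T}) c : complete_fan K q -> r \in K ->
  \sum_(x in r) c x *: q x = 0 -> forall x, x \in r -> c x = 0.
Proof.
case=> _ _ uni rK c0 x xr.
(* Large enough to make every [M + c y] with [y] in [r] positive. *)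
pose M := 1 + \sum_(y in r) `|c y|.
have ltM y : y \in r -> 0 < M + c y.
  move=> yr; rewrite /M (bigD1 y) //=.
  have : 0 <= \sum_(i in r | i != y) `|c i| by apply: sumr_ge0.
  by have := ler_norm (- c y); rewrite normrN; lra.
have M0 : 0 < M by rewrite /M; have : 0 <= \sum_(y in r) `|c y| by [apply: sumr_ge0]; lra.
pose a y := if y \in r then M else 0.
pose b y := if y \in r then M + c y else 0.
have sa : supp a = r by apply/setP => y; rewrite inE /a; case: ifP => //; rewrite ?eqxx ?gt_eqF.
have sb : supp b = r.
  by apply/setP => y; rewrite inE /b; case: ifP => [yr|]; rewrite ?eqxx // gt_eqF // ltM.
suff /(_ x) : a =1 b by rewrite /a /b xr -{1}[M]addr0 => /addrI.
apply: uni; rewrite /in_cone ?sa ?sb.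
- by split=> // y; rewrite /a; case: ifP => // _; apply: ltW.
- by split=> // y; rewrite /b; case: ifP => // yr; apply/ltW/ltM.
rewrite (@sum_supp q a r) ?sa // (@sum_supp q b r) ?sb //.
rewrite [RHS](eq_bigr (fun x => a x *: q x + c x *: q x)); last first.
  by move=> y yr; rewrite /a /b yr scalerDl.
by rewrite big_split /= c0 addr0.
Qed.

Lemma fan_card K q (r : {set T}) : complete_fan K q -> r \in K -> (#|r| <= m)%N.
Proof.
move=> fK rK; pose A := \matrix_(i < #|r|) q (enum_val i).
suff : row_free A by rewrite /row_free => /eqP <-; apply: rank_leq_col.
apply: inj_row_free => v vA; apply/rowP => i; rewrite mxE.
pose c x := \sum_(i | enum_val i == x) v 0 i.
have cE j : c (enum_val j) = v 0 j.
  rewrite /c (bigD1 j) //= big1 ?addr0 // => l /andP[/eqP /enum_val_inj -> ].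
  by rewrite eqxx.
rewrite -cE; apply: (fan_free fK rK); last exact: enum_valP.
rewrite big_enum_val /= -[RHS]vA mulmx_sum_row; apply: eq_bigr => j _.
by rewrite cE rowK.
Qed.

Lemma exists_nonroot (f : {poly R}) : f != 0 -> exists t, ~~ root f t.
Proof.
(* These are [size f] distinct points, more than a nonzero [f] can have as roots. *)
move=> f0; pose rs : seq R := [seq i%:R | i <- iota 0 (size f)].
have : ~~ all (root f) rs.
  apply/negP => /(max_poly_roots f0); rewrite map_inj_uniq ?iota_uniq.
    by move=> /(_ isT); rewrite size_map size_iota ltnn.
  by move=> i j /eqP; rewrite eqr_nat => /eqP.
by case/allPn => t _ nt; exists t.
Qed.

Definition generic q (v : 'rV[R]_m) : Prop := forall (s : {set T}) c,
  v = \sum_(x in s) c x *: q x -> (m <= #|s|)%N.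

(* A point of the moment curve avoids any finite set of proper subspaces. *)
Lemma generic_vector q : exists v, generic q v.
Proof.
have H (s : {set T}) : exists f : {poly R}, f != 0 /\ ((#|s| < m)%N ->
    forall t c, \row_i t ^+ i = \sum_(x in s) c x *: q x -> root f t).
  case: (ltnP #|s| m) => [sm|_]; last by exists 1; rewrite oner_eq0.
  pose A := \matrix_(i < #|s|) q (enum_val i).
  have : ~~ row_free A^T.
    rewrite /row_free; apply/negP => /eqP h; have := rank_leq_col A^T.
    by rewrite h leqNgt sm.
  rewrite -kermx_eq0 => /rowV0Pn[u /sub_kermxP uA u0].
  (* The linear form [u] vanishes on every [q x] with [x] in [s]; [f] is its value along the moment
     curve. *)
  pose f : {poly R} := \sum_(i < m) u 0 i *: 'X^i.
  have fE (i : 'I_m) : f`_i = u 0 i.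
    rewrite /f coef_sum (bigD1 i) //= coefZ coefXn eqxx mulr1 big1 ?addr0 // => l li.
    by rewrite coefZ coefXn eq_sym (inj_eq val_inj) (negPf li) mulr0.
  exists f; split.
    apply: contraNneq u0 => f0; apply/eqP/rowP => i.
    by rewrite -fE f0 coef0 mxE.
  move=> _ t c tc; apply/rootP.
  have -> : f.[t] = ((\row_(i < m) t ^+ i) *m u^T) 0 0.
    rewrite /f horner_sum mxE; apply: eq_bigr => i _.
    by rewrite hornerZ hornerXn !mxE mulrC.
  rewrite tc mulmx_suml summxE big1 // => x xs; rewrite -scalemxAl mxE.
  have /matrixP/(_ 0 (enum_rank_in xs x)) := uA.
  rewrite !mxE => h; rewrite [X in _ * X](_ : _ = 0) ?mulr0 // -[RHS]h.
  apply: eq_bigr => i _; rewrite !mxE enum_rankK_in // mulrC //.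
pose F s := projT1 (cid (H s)).
have /exists_nonroot[t nt] : \prod_s F s != 0.
  by apply/prodf_neq0 => s _; rewrite /F; case: cid => f [].
exists (\row_(i < m) t ^+ i) => s c tc; rewrite leqNgt; apply/negP => sm.
case/negP: nt; rewrite /root horner_prod; apply/prodf_eq0; exists s => //.
by rewrite /F; case: cid => f /= [_ /(_ sm _ _ tc)].
Qed.

Lemma pigeonhole_infinite (C : finType) (f : nat -> C) :
  exists i, forall N, exists2 n, (N <= n)%N & f n = i.
Proof.
apply: contrapT => h.
have {}h i : exists N, forall n, (N <= n)%N -> f n <> i.
  apply: contrapT => h'; apply: h; exists i => N; apply: contrapT => h''.
  by apply: h'; exists N => n Nn fn; apply: h''; exists n.
pose B i := projT1 (cid (h i)).
pose M := (\max_i B i)%N.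
have := projT2 (cid (h (f M))) M; apply => //.
exact: (@leq_bigmax _ B (f M)).
Qed.

(* The point [sum_(x in t) q x + eps *: v] lies in the relative interior of
   the cone spanned by [r] for all small [eps > 0]. *)
Definition points_into K q (v : 'rV[R]_m) (t r : {set T}) c : Prop :=
  [/\ r \in K, t \subset r, v = \sum_(x in r) c x *: q x
    & forall x, x \in r :\: t -> 0 < c x].

(** Instead of [z + eps *: v] for small [eps], use [N%:R *: z + v] for large [N]. Infinitely many
    [N] share a support [r], where the coefficients are [N%:R * d x + c x]. Uniqueness for [z] makes
    [d] the indicator of [t], so off [t] the number [c x] is itself a positive coefficient. *)
Lemma points_into_exists K q v (t : {set T}) : complete_fan K q -> t \in K ->
  exists r c, points_into K q v t r c.
Proof.
move=> fK tK; have [[K0 Kd] ex uni] := fK.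
pose z := \sum_(x in t) q x.
have H N : exists a, in_cone K a /\ \sum_x a x *: q x = N%:R *: z + v.
  by have [a ca aE] := ex (N%:R *: z + v); exists a.
pose a N := projT1 (cid (H N)).
have aK N : in_cone K (a N) by have [] := projT2 (cid (H N)).
have aE N : \sum_x a N x *: q x = N%:R *: z + v by have [] := projT2 (cid (H N)).
have [r rP] := pigeonhole_infinite (fun N => supp (a N)).
have [N1 _ s1] := rP 0%N; have [N2 lt12 s2] := rP N1.+1.
have rK : r \in K by rewrite -s1; have [] := aK N1.
have aEr N : supp (a N) = r -> \sum_(x in r) a N x *: q x = N%:R *: z + v.
  by move=> sN; rewrite -aE (@sum_supp q _ r) ?sN.
pose e : R := N2%:R - N1%:R.
have e0 : 0 < e by rewrite subr_gt0 ltr_nat.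
(* Slope and intercept of the coefficients as affine functions of [N], read off from two values with
   support [r]. *)
pose d x := (a N2 x - a N1 x) / e.
pose c x := a N1 x - N1%:R * d x.
have dE : \sum_(x in r) d x *: q x = z.
  rewrite (eq_bigr (fun x => e^-1 *: (a N2 x *: q x - a N1 x *: q x))); last first.
    by move=> x _; rewrite -scalerBl scalerA mulrC.
  rewrite -scaler_sumr sumrB !aEr // opprD addrACA subrr addr0 -scalerBl.
  by rewrite scalerA mulVf ?scale1r // gt_eqF.
have cE : \sum_(x in r) c x *: q x = v.
  rewrite (eq_bigr (fun x => a N1 x *: q x - N1%:R *: (d x *: q x))); last first.
    by move=> x _; rewrite scalerA -scalerBl.
  by rewrite sumrB -scaler_sumr dE aEr // addrAC subrr add0r.
have aNE N x : supp (a N) = r -> x \in r -> a N x = N%:R * d x + c x.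
  move=> sN xr; apply/eqP; rewrite -subr_eq0; apply/eqP.
  apply: (fan_free (c := fun x => a N x - (N%:R * d x + c x)) fK rK) xr.
  rewrite (eq_bigr (fun x => a N x *: q x -
      (N%:R *: (d x *: q x) + c x *: q x))); last first.
    by move=> y _; rewrite scalerA -scalerDl -scalerBl.
  by rewrite sumrB big_split /= -scaler_sumr dE cE aEr // subrr.
have d_ge0 x : x \in r -> 0 <= d x.
  (* A negative slope would make the coefficient negative once [N] exceeds the absolute value of
     [c x / d x]. *)
  move=> xr; rewrite leNgt; apply/negP => dx.
  have [N ltN sN] := rP (Num.bound `|c x / d x|).
  have := (aK N).1 x; rewrite (aNE N) // leNgt => /negP; apply.
  have cd : - (c x / d x) < N%:R.
    apply: le_lt_trans (lt_le_trans (archi_boundP (normr_ge0 (c x / d x))) _).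
      by rewrite -normrN ler_norm.
    by rewrite ler_nat.
  by move: cd; rewrite -mulNr ltr_ndivrMr //; lra.
pose d' x := if x \in r then d x else 0.
have sd' : supp d' \subset r.
  by apply/subsetP => x; rewrite inE /d'; case: ifP; rewrite ?eqxx.
pose b x : R := if x \in t then 1 else 0.
have sb : supp b = t.
  by apply/setP => x; rewrite inE /b; case: ifP; rewrite ?eqxx ?oner_eq0.
have db : d' =1 b.
  apply: uni.
  - split; last exact: Kd sd'.
    by move=> x; rewrite /d'; case: ifP => // /d_ge0.
  - by split; rewrite ?sb // => x; rewrite /b; case: ifP; rewrite ?ler01.
  rewrite (sum_supp _ sd') (@sum_supp q b t) ?sb //.
  rewrite (eq_bigr (fun x => d x *: q x)); last by move=> x xr; rewrite /d' xr.
  by rewrite dE; apply: eq_bigr => x xt; rewrite /b xt scale1r.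
exists r, c; split=> //.
  apply/subsetP => x xt; have := db x; rewrite /d' /b xt.
  by case: ifP => // _ /esym/eqP; rewrite oner_eq0.
move=> x; rewrite inE => /andP[xt xr]; rewrite lt_neqAle eq_sym.
have dx0 : d x = 0 by have := db x; rewrite /d' /b xr (negPf xt).
have cx : c x = a N1 x by rewrite /c dx0 mulr0 subr0.
by rewrite cx (aK N1).1 andbT; move: xr; rewrite -s1 inE.
Qed.

(** For one large [M] the vector [M *: z + v], with [z] the sum of [q x] over [t], has positive
    coordinates on all of [r] and also on all of [r']; the fan gives it a single support. *)
Lemma points_into_unique K q v (t r r' : {set T}) c c' : complete_fan K q ->
  points_into K q v t r c -> points_into K q v t r' c' -> r = r'.
Proof.
move=> [_ _ uni] [rK tr vE cp] [r'K tr' vE' cp'].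
pose M : R := 1 + \sum_x (`|c x| + `|c' x|).
have Mc x : 0 < M + c x /\ 0 < M + c' x.
  rewrite /M (bigD1 x) //=.
  have : 0 <= \sum_(i | i != x) (`|c i| + `|c' i|).
    by apply: sumr_ge0 => i _; apply: addr_ge0.
  have := ler_norm (- c x); have := ler_norm (- c' x); rewrite !normrN.
  have := normr_ge0 (c x); have := normr_ge0 (c' x).
  by split; lra.
pose a (r : {set T}) c x := if x \in r then (if x \in t then M else 0) + c x else 0.
have key (s : {set T}) e : points_into K q v t s e -> (forall x, 0 < M + e x) ->
    [/\ in_cone K (a s e), supp (a s e) = s
      & \sum_x a s e x *: q x = M *: (\sum_(x in t) q x) + v].
  case=> sK ts sE ep Me.
  have a_gt0 x : x \in s -> 0 < a s e x.
    move=> xs; rewrite /a xs; case: (boolP (x \in t)) => // xt.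
    by rewrite add0r ep // inE xt.
  have sa : supp (a s e) = s.
    apply/setP => x; rewrite inE; case: (boolP (x \in s)) => xs.
      by rewrite gt_eqF ?a_gt0.
    by rewrite /a (negPf xs) eqxx.
  split=> //.
    split; last by rewrite sa.
    move=> x; case: (boolP (x \in s)) => [/a_gt0 /ltW //|xs].
    by rewrite /a (negPf xs).
  rewrite (@sum_supp q _ s) ?sa // sE.
  rewrite (eq_bigr (fun x => (if x \in t then M *: q x else 0) + e x *: q x)); last first.
    by move=> x xs; rewrite /a xs scalerDl; case: ifP; rewrite ?scale0r.
  rewrite big_split /= scaler_sumr; congr (_ + _).
  rewrite -big_mkcondr /=; apply: eq_bigl => x.
  by case: (boolP (x \in t)) => [/(subsetP ts) -> //|]; rewrite andbF.
have [] := key r c; first by split.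
  by move=> x; have [] := Mc x.
move=> c1 s1 e1; have [] := key r' c'; first by split.
  by move=> x; have [] := Mc x.
move=> c2 s2 e2.
rewrite -s1 -s2; apply/setP => x; rewrite !inE.
by rewrite (uni _ _ c1 c2) // e1 e2.
Qed.

End Fans.

Section DehnSommerville.
Variables (R : archiRealFieldType) (m : nat) (T : finType).
Variables (K : {set {set T}}) (q : T -> 'rV[R]_m).
Hypothesis fK : complete_fan K q.

(** A zero coefficient would put [v] in the span of [r] without [x], which has fewer than [m]
    elements by [fan_card]. *)
Lemma generic_coef_neq0 v (r : {set T}) c x : generic q v -> r \in K ->
  v = \sum_(y in r) c y *: q y -> x \in r -> c x != 0.
Proof.
move=> gv rK vE xr; apply/eqP => cx0.
have := gv (r :\ x) c; rewrite vE (big_setD1 x) //= cx0 scale0r add0r.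
by move=> /(_ erefl); have := fan_card fK rK; rewrite (cardsD1 x) xr; lia.
Qed.

(** The two hypotheses on [G] make it the set of faces whose linear span contains [v]. Each [u] is
    assigned to the one [r] it points into; after exchanging the sums, the [u] assigned to [r] form
    an interval handled by [sum_powers_between]. *)
Lemma half_open_decomposition (A : comNzRingType) v (G : {set {set T}})
    (c : {set T} -> T -> R) (s : {set T}) (t : A) :
  generic q v ->
  (forall r, r \in G -> r \in K /\ v = \sum_(x in r) c r x *: q x) ->
  (forall r e, r \in K -> v = \sum_(x in r) e x *: q x -> r \in G) ->
  \sum_(u in K | s \subset u) t ^+ #|u :\: s|
    = \sum_(r in G | s \subset r)
        \prod_(x in r :\: s) (if 0 < c r x then 1 + t else t).
Proof.
move=> gv GP PG.
pose into (u r : {set T}) := (u \subset r) && [forall x in r :\: u, 0 < c r x].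
have intoP u r : r \in G -> into u r -> points_into K q v u r (c r).
  by move=> /GP[rK vE] /andP[ur /forall_inP h]; split.
have into1 u : u \in K -> exists2 r, r \in G & into u r.
  move=> uK; have [r [e [rK ur vE ep]]] := points_into_exists v fK uK.
  have rG := PG _ _ rK vE; exists r; rewrite // /into ur; apply/forall_inP => x.
  move=> xru; have [_ vE'] := GP _ rG.
  have xr : x \in r by move: xru; rewrite inE => /andP[].
  suff -> : c r x = e x by apply: ep.
  apply/eqP; rewrite -subr_eq0; apply/eqP.
  apply: (fan_free (c := fun x => c r x - e x) fK rK) xr.
  rewrite (eq_bigr (fun x => c r x *: q x - e x *: q x)).
    by rewrite sumrB -vE -vE' subrr.
  by move=> y _; rewrite scalerBl.
transitivity (\sum_(u in K | s \subset u) \sum_(r in G | into u r) t ^+ #|u :\: s|).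
  apply: eq_bigr => u /andP[uK su]; have [r rG ur] := into1 _ uK.
  rewrite (big_pred1 r) // => r' /=; apply/andP/eqP => [[r'G ur']|-> //].
  exact: points_into_unique fK (intoP _ _ r'G ur') (intoP _ _ rG ur).
rewrite (exchange_big_dep (fun r => (r \in G) && (s \subset r))) /=; last first.
  move=> u r /andP[uK su] /andP[-> /andP[ur _]]; exact: subset_trans ur.
apply: eq_bigr => r /andP[rG sr]; have [rK _] := GP _ rG.
have [_ Kd] : simplicial_complex K by case: fK.
rewrite -sum_powers_between //; apply: eq_bigl => u.
rewrite rG /into /=; case: (boolP (u \subset r)) => ur; last by rewrite ?andbF.
by rewrite (Kd _ _ rK ur).
Qed.

(* Opposite generic vectors give half-open decompositions with the roles of
   closed and open sides exchanged. *)
Theorem dehn_sommerville (A : comNzRingType) (s : {set T}) (t : A) :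
  \sum_(u in K | s \subset u) (- 1 - t) ^+ #|u :\: s|
    = (- 1) ^+ (m - #|s|) * \sum_(u in K | s \subset u) t ^+ #|u :\: s|.
Proof.
have [v gv] := generic_vector q.
(* A span contains [v] exactly when it contains [- v], so this one set serves both
   decompositions. *)
pose G := [set r in K | `[< exists c : T -> R, v = \sum_(x in r) c x *: q x >]].
have H (r : {set T}) : exists c : T -> R, r \in G -> v = \sum_(x in r) c x *: q x.
  case: (boolP (r \in G)) => rG; last by exists (fun=> 0).
  by move: rG; rewrite inE => /andP[_ /asboolP[c cE]]; exists c.
pose c r := projT1 (cid (H r)).
have GP r : r \in G -> r \in K /\ v = \sum_(x in r) c r x *: q x.
  move=> rG; split; first by move: rG; rewrite inE => /andP[].
  by rewrite {1}(projT2 (cid (H r)) rG).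
have PG r (e : T -> R) : r \in K -> v = \sum_(x in r) e x *: q x -> r \in G.
  by move=> rK vE; rewrite inE rK; apply/asboolP; exists e.
have gNv : generic q (- v).
  move=> r e /(congr1 -%R); rewrite opprK -sumrN => vE.
  by apply: (gv r (fun x => - e x)); rewrite vE; apply: eq_bigr => x _; rewrite scaleNr.
rewrite (half_open_decomposition _ _ gv GP PG).
rewrite (half_open_decomposition (c := fun r x => - c r x) (G := G) _ _ gNv); first last.
- move=> r e rK /(congr1 -%R); rewrite opprK -sumrN => vE.
  by apply: (PG r (fun x => - e x)) => //; rewrite vE; apply: eq_bigr => x _; rewrite scaleNr.
- move=> r rG; have [rK vE] := GP _ rG; split=> //.
  by rewrite {1}vE -sumrN; apply: eq_bigr => x _; rewrite scaleNr.
rewrite big_distrr /=; apply: eq_bigr => r /andP[rG sr].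
have [rK vE] := GP _ rG.
have -> : (m - #|s|)%N = #|r :\: s|.
  by rewrite cardsDS // (eqP (_ : m == #|r|)) // eqn_leq (fan_card fK rK) (gv _ _ vE).
(* No coefficient is zero, so reversing [v] swaps the two kinds of factor. Since 1 + (-1 - t) = -t
   and -1 - t = -(1 + t), each element of [r :\: s] contributes one sign. *)
rewrite -prodrN; apply: eq_bigr => x; rewrite inE => /andP[_ xr].
have := generic_coef_neq0 gv rK vE xr; rewrite neq_lt oppr_gt0.
by case: ltgtP => // _ _; ring.
Qed.

(** The face entered from [s] in a generic direction contains that direction in its span, hence has
    [m] elements. *)
Lemma exists_facet (s : {set T}) : s \in K ->
  exists r, [/\ r \in K, s \subset r & #|r| = m].
Proof.
move=> sK; have [v gv] := generic_vector q.
have [r [c [rK sr vE _]]] := points_into_exists v fK sK.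
exists r; split=> //; apply/eqP; rewrite eqn_leq (fan_card fK rK).
exact: gv vE.
Qed.

End DehnSommerville.

(** * The F-polynomial of a link *)

Section FPolynomial.
Variables (R : realType) (T : finType).
Implicit Types (K : {set {set T}}) (s : {set T}).

Lemma FpolyE K : Fpoly R K = \sum_(s in K) (2^-1 *: ('X - 1)) ^+ #|s|.
Proof.
rewrite (partition_big (fun s : {set T} => inord #|s| : 'I_(card_bound K).+1) predT) //=.
apply: eq_bigr => i _; rewrite /face_number -sum1_card natr_sum scaler_suml.
apply: eq_big => s; rewrite !inE.
  case: (boolP (s \in K)) => //= sK; rewrite -val_eqE /= inordK //.
  by rewrite ltnS; exact: (@leq_bigmax_cond _ (fun u => u \in K) (fun u => #|u|) s sK).
by case/andP => _ /eqP ->; rewrite scale1r.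
Qed.

Lemma Fpoly_link K s : simplicial_complex K -> s \in K ->
  Fpoly R (link K s) = \sum_(u in K | s \subset u) (2^-1 *: ('X - 1)) ^+ #|u :\: s|.
Proof.
move=> [K0 Kd] sK; rewrite FpolyE.
rewrite [RHS](reindex_onto (fun t => s :|: t) (fun u => u :\: s)); last first.
  by move=> u /andP[_ su]; rewrite -[RHS](setID _ s) (setIidPr su).
have UD t : ((s :|: t) :\: s == t) = [disjoint s & t].
  by rewrite setDUl setDv set0U disjoint_sym; apply/eqP/finset.setDidPl.
apply: eq_big => [t|t]; rewrite ?inE ?subsetUl ?UD.
  rewrite andbT /= andbC; case: (boolP (s :|: t \in K)) => stK; last by rewrite !andbF.
  by rewrite (Kd _ _ stK) ?subsetUr ?andbT //.
by case/and3P=> _ dst _; rewrite (eqP (_ : (s :|: t) :\: s == t)) // UD.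
Qed.

Lemma coef_half_power e n : (e <= n)%N ->
  ((2^-1 *: ('X - 1)) ^+ e : {poly R})`_n = 2^-1 ^+ n *+ (e == n).
Proof.
rewrite -polyC1 exprZn coefZ => en.
have monX : ('X - 1%:P) ^+ e \is @monic R by rewrite monic_exp ?monicXsubC.
have sz := size_exp_XsubC e (1 : R).
case: eqP => [<-|/eqP ne].
  by have /monicP := monX; rewrite lead_coefE sz /= => ->; rewrite mulr1.
by rewrite nth_default ?mulr0 // sz ltn_neqAle ne.
Qed.

(** In the variable t = (x - 1)/2 the reflection of x at 0 is the substitution of -1 - t for t, the
    one in [dehn_sommerville]. *)
Lemma comp_half_powerN e :
  ((2^-1 *: ('X - 1)) ^+ e : {poly R}) \Po (- 'X)
    = (- 1 - 2^-1 *: ('X - 1)) ^+ e.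
Proof.
rewrite rmorphXn /= -polyC1 linearZ /= linearB /= comp_polyX comp_polyC.
congr (_ ^+ e); rewrite !scalerBr -polyCN.
apply/polyP => i; rewrite !coefE; case: (i == 0)%N; case: (i == 1)%N => /=; lra.
Qed.

End FPolynomial.

(** * Degree, symmetry and positivity for links in a complete fan *)

Section LinksInFans.
Variables (R : realType) (m : nat) (T : finType).
Variables (K : {set {set T}}) (q : T -> 'rV[R]_m) (s : {set T}).
Hypotheses (fK : complete_fan K q) (sK : s \in K).

Let FE : Fpoly R (link K s)
  = \sum_(u in K | s \subset u) (2^-1 *: ('X - 1)) ^+ #|u :\: s|.
Proof. by apply: Fpoly_link => //; case: fK. Qed.

Let card_diff u : (u \in K) && (s \subset u) -> (#|u :\: s| <= m - #|s|)%N.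
Proof.
by case/andP=> uK su; rewrite cardsDS // leq_sub2r // (fan_card fK).
Qed.

Lemma size_link_fan : (size (Fpoly R (link K s)) <= (m - #|s|).+1)%N.
Proof.
rewrite FE; apply: leq_trans (size_sum _ _ _) _; apply/bigmax_leqP => u /card_diff h.
rewrite (leq_trans (size_poly_exp_leq _ _)) // size_scale ?invr_eq0 ?pnatr_eq0 //.
by rewrite size_XsubC mul1n ltnS.
Qed.

(** Only faces with [m] elements reach this degree, each contributing the same power of 1/2, and
    [exists_facet] supplies one through [s]. *)
Lemma coef_link_fan : 0 < (Fpoly R (link K s))`_(m - #|s|).
Proof.
have h2 : 0 < 2^-1 ^+ (m - #|s|) :> R by rewrite exprn_gt0 // invr_gt0.
rewrite FE coef_sum; have [r [rK sr rm]] := exists_facet fK sK.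
rewrite (bigD1 r) ?rK //= ltr_pwDl //.
  by rewrite coef_half_power cardsDS // rm ?eqxx.
apply: sumr_ge0 => u /andP[/card_diff h _].
by rewrite coef_half_power // mulrn_wge0 // ltW.
Qed.

Lemma link_fan_symmetric :
  Fpoly R (link K s) \Po (- 'X) = (- 1) ^+ (m - #|s|) *: Fpoly R (link K s).
Proof.
rewrite FE raddf_sum /= (eq_bigr _ (fun u _ => comp_half_powerN R #|u :\: s|)).
rewrite (dehn_sommerville fK).
by rewrite -[RHS]mul_polyC polyC_exp polyCN.
Qed.

Lemma link_fan_gt0 x : 1 < x -> 0 < (Fpoly R (link K s)).[x].
Proof.
move=> x1; have h : 0 < 2^-1 * (x - 1) by rewrite mulr_gt0 ?invr_gt0 // subr_gt0.
have hE e : ((2^-1 *: ('X - 1)) ^+ e).[x] = (2^-1 * (x - 1)) ^+ e.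
  by rewrite horner_exp hornerZ hornerD hornerN hornerX hornerC.
rewrite FE horner_sum (bigD1 s) ?sK //= ltr_pwDl //.
  by rewrite hE exprn_gt0.
by apply: sumr_ge0 => u _; rewrite hE exprn_ge0 // ltW.
Qed.

End LinksInFans.

(** * The cross-polytope *)
Section CrossPolytope.
Variables (R : realType) (m : nat) (C : finType).
Let T : finType := ('I_m * bool + C)%type.
Implicit Type (u : {set T}).

(* The elements of [C] are spare vertex names for later subdivisions. *)
Definition cross_polytope : {set {set T}} :=
  [set u : {set T} | [forall z : C, inr z \notin u] &&
     [forall i : 'I_m, ~~ ((inl (i, true) \in u) && (inl (i, false) \in u))]].

Lemma cross_polytopeP u : reflect
  ((forall z : C, inr z \notin u) /\
   forall i : 'I_m, ~~ ((inl (i, true) \in u) && (inl (i, false) \in u)))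
  (u \in cross_polytope).
Proof. by rewrite inE; apply: (iffP andP) => -[/forallP h1 /forallP h2]. Qed.

Lemma simplicial_cross_polytope : simplicial_complex cross_polytope.
Proof.
split; first by apply/cross_polytopeP; split => *; rewrite !inE.
move=> u v /cross_polytopeP[u1 u2] /subsetP vu; apply/cross_polytopeP; split.
  by move=> z; apply: contra (u1 z); apply: vu.
by move=> i; apply: contra (u2 i) => /andP[/vu -> /vu ->].
Qed.

(** The cones over the facets are the orthants; [0] is a placeholder for names not yet in use. *)
Definition cross_position (x : T) : 'rV[R]_m :=
  match x with
  | inl (i, b) => (if b then 1 else - 1) *: delta_mx 0 i
  | inr _ => 0
  end.

Lemma sum_cross_position (a : T -> R) :
  \sum_x a x *: cross_position x = \row_i (a (inl (i, true)) - a (inl (i, false))).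
Proof.
rewrite big_sumType /= [X in _ + X]big1 => [|z _]; last by rewrite scaler0.
rewrite addr0 (eq_bigr (fun p : 'I_m * bool =>
  (fun i b => a (inl (i, b)) *: cross_position (inl (i, b))) p.1 p.2)); last by case.
rewrite -(pair_bigA _ (fun i b => a (inl (i, b)) *: cross_position (inl (i, b)))) /=.
rewrite [RHS]row_sum_delta; apply: eq_bigr => i _.
by rewrite big_bool /= scale1r scaleN1r mxE scalerN scalerBl.
Qed.

(** Existence and uniqueness are those of the splitting of each coordinate into positive and
    negative parts, at most one of them nonzero. *)
Lemma fan_cross_polytope : complete_fan cross_polytope cross_position.
Proof.
split; first exact: simplicial_cross_polytope.
- move=> y; pose a (x : T) := match x with
    | inl (i, b) => if b then Num.max (y 0 i) 0 else Num.max (- y 0 i) 0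
    | inr _ => 0 end.
  exists a.
    split; first by case=> [[i []]|z] /=; rewrite ?le_max ?lexx ?orbT.
    apply/cross_polytopeP; split => [z|i]; rewrite !inE /= ?eqxx //.
    by rewrite !maxEle; case: leP => h1; case: leP => h2; rewrite ?eqxx ?andbF //; exfalso; lra.
  rewrite sum_cross_position; apply/rowP => i; rewrite mxE /=.
  by rewrite !maxEle; case: leP => h1; case: leP => h2; lra.
move=> a b [a0 /cross_polytopeP[a1 a2]] [b0 /cross_polytopeP[b1 b2]].
rewrite !sum_cross_position => /rowP ab [[i s]|z].
  have := ab i; rewrite !mxE; have := a2 i; have := b2 i; rewrite !inE.
  move: (a0 (inl (i, true))) (a0 (inl (i, false))) (b0 (inl (i, true))) (b0 (inl (i, false))).
  by rewrite !negb_and !negbK => ? ? ? ? /orP[]/eqP h1 /orP[]/eqP h2 h3; case: s; lra.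
by have := a1 z; have := b1 z; rewrite !inE !negbK => /eqP -> /eqP ->.
Qed.

(** A face chooses, for each coordinate independently, no vertex or one of two. The sum therefore
    factors into [m] copies of 1 + 2h with h = (X - 1)/2, that is, of X. *)
Lemma Fpoly_cross_polytope : Fpoly R cross_polytope = 'X^m.
Proof.
rewrite FpolyE.
pose F (f : {ffun 'I_m -> option bool}) : {set T} :=
  [set x | if x is inl (i, b) then f i == Some b else false].
pose G u : {ffun 'I_m -> option bool} :=
  [ffun i => if inl (i, true) \in u then Some true
             else if inl (i, false) \in u then Some false else None].
rewrite (reindex_onto F G); last first.
  move=> u /cross_polytopeP[u1 u2]; apply/setP => -[[i b]|z]; rewrite inE ?ffunE.
    have := u2 i; case: b; case: (inl (i, true) \in u);
    by case: (inl (i, false) \in u).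
  by rewrite (negPf (u1 z)).
pose h : {poly R} := 2^-1 *: ('X - 1).
pose H (o : option bool) := if o is Some _ then h else 1.
transitivity (\sum_(f : {ffun 'I_m -> option bool}) \prod_i H (f i)).
  apply: eq_big => [f|f _].
    apply/andP; split.
      apply/cross_polytopeP; split=> [z|i]; rewrite !inE //.
      by case: (f i) => [[]|].
    apply/eqP/ffunP => i; rewrite ffunE !inE; by case: (f i) => [[]|].
  rewrite -prodr_const big_mkcond big_sumType /= [X in _ * X]big1 ?mulr1; last first.
    by move=> z _; rewrite inE.
  rewrite (eq_bigr (fun p : 'I_m * bool =>
    (fun i b => if f i == Some b then h else 1) p.1 p.2)); last first.
    by move=> [i b] _ /=; rewrite inE.
  rewrite -(pair_bigA _ (fun i b => if f i == Some b then h else 1)) /=.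
  by apply: eq_bigr => i _; rewrite big_bool /=; case: (f i) => [[]|] /=; rewrite ?mulr1 ?mul1r.
rewrite -(bigA_distr_bigA (fun _ => H)) /=.
have -> : \sum_o H o = 'X.
  rewrite (bigD1 None) //= (bigD1 (Some true)) //= (bigD1 (Some false)) //= big1.
    rewrite addr0 /h -scalerDr -mulr2n -scaler_nat scalerA mulVf ?pnatr_eq0 //.
    by rewrite scale1r addrC subrK.
  by case=> [[]|].
by rewrite prodr_const card_ord.
Qed.

Lemma exists_cross_polytope_face (n : nat) : (n <= m)%N ->
  exists2 s, s \in cross_polytope & #|s| = n.
Proof.
move=> nm; exists [set inl (widen_ord nm i, true) | i : 'I_n]%SET; last first.
  by rewrite card_imset ?card_ord // => i j [] ij; apply: val_inj.
apply/cross_polytopeP; split=> [z|i]; first by apply/imsetP => -[].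
by rewrite negb_and; apply/orP; right; apply/imsetP => -[].
Qed.

End CrossPolytope.

(** * Triangulations of the simplex *)
Lemma supp_vertices (R : archiRealFieldType) (T : finType) (K : {set {set T}})
    (a : T -> R) x :
  simplicial_complex K -> supp a \in K -> a x != 0 -> x \in vertices K.
Proof.
by move=> [_ Kd] aK ax; rewrite inE; apply: (Kd _ _ aK); rewrite sub1set inE.
Qed.

Section TriangulatedSimplex.
Variables (R : realType) (k : nat) (W : finType).
Variables (L : {set {set W}}) (p : W -> 'rV[R]_k.+1).
Hypotheses (hk : (1 <= k)%N) (hL : triangulation L p).
Hypothesis hbd : no_new_boundary_vertices L p.

Let Lsimp : simplicial_complex L. Proof. by case: hL. Qed.

Lemma vertex_in_simplex w : w \in vertices L -> std_simplex (p w).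
Proof.
rewrite inE => wL; have [_ _ _ <-] := hL; exists [set w]%SET => //=.
by exists (fun=> 1); split=> //; rewrite big_set1 ?scale1r.
Qed.

Lemma vertex_ge0 w i : w \in vertices L -> 0 <= p w 0 i.
Proof. by move=> /vertex_in_simplex[]. Qed.

Lemma vertex_sum w : w \in vertices L -> \sum_i p w 0 i = 1.
Proof. by move=> /vertex_in_simplex[]. Qed.

(** Dividing by the coordinate sum [l] moves a nonzero [z] into the simplex, where some face of [L]
    covers it; the coefficients are then scaled back. *)
Lemma simplex_cone_exists (z : 'rV[R]_k.+1) : (forall i, 0 <= z 0 i) ->
  exists2 b, in_cone L b & \sum_w b w *: p w = z.
Proof.
move=> z0; pose l := \sum_i z 0 i.
have l0 : 0 <= l by apply: sumr_ge0.
have supp0 : supp (fun=> 0 : R) = set0 :> {set W} by apply/setP => w; rewrite !inE eqxx.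
have [lz|lnz] := eqVneq l 0.
  exists (fun=> 0); first by split=> //; rewrite supp0; case: Lsimp.
  rewrite big1 => [|w _]; last by rewrite scale0r.
  apply/rowP => i; rewrite mxE; symmetry.
  by apply: (psumr_eq0P (fun i _ => z0 i) lz).
have : std_simplex (l^-1 *: z).
  split=> [i|]; first by rewrite mxE mulr_ge0 ?invr_ge0.
  by under eq_bigr do rewrite mxE; rewrite -mulr_sumr mulVf.
have [_ _ _ <-] := hL => -[s /= sL [a [a0 _ aE]]].
pose b w := if w \in s then l * a w else 0.
have sb : supp b \subset s.
  by apply/subsetP => w; rewrite inE /b; case: ifP; rewrite ?eqxx.
exists b; first split.
- by move=> w; rewrite /b; case: ifP => // _; rewrite mulr_ge0.
- exact: (Lsimp.2 _ _ sL sb).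
rewrite (sum_supp _ sb) (eq_bigr (fun w => l *: (a w *: p w))); last first.
  by move=> w ws; rewrite /b ws scalerA.
by rewrite -scaler_sumr -aE scalerA divff ?scale1r.
Qed.

Lemma cone_total (b : W -> R) : in_cone L b ->
  \sum_i (\sum_w b w *: p w) 0 i = \sum_w b w.
Proof.
move=> [b0 bL]; under eq_bigr do rewrite summxE.
rewrite exchange_big /=; apply: eq_bigr => w _.
have [->|bw] := eqVneq (b w) 0; first by rewrite big1 // => i _; rewrite scale0r mxE.
under eq_bigr do rewrite mxE.
by rewrite -mulr_sumr vertex_sum ?mulr1 // (supp_vertices Lsimp bL).
Qed.

(** Both combinations have total [l] by [cone_total]. After division by [l] they give one point in
    the hulls of both supports, hence in the hull of the common face. Affine independence then
    equates each with the coefficients [d] on that face. *)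
Lemma simplex_cone_unique (b b' : W -> R) : in_cone L b -> in_cone L b' ->
  \sum_w b w *: p w = \sum_w b' w *: p w -> b =1 b'.
Proof.
move=> cb cb' bb'; pose l := \sum_w b w.
have lE : l = \sum_w b' w by rewrite -(cone_total cb') -bb' cone_total.
have l0 : 0 <= l by apply: sumr_ge0 => w _; case: cb.
have [lz|lnz] := eqVneq l 0.
  move=> w; rewrite (psumr_eq0P (fun w _ => cb.1 w) lz) //.
  by rewrite (psumr_eq0P (fun w _ => cb'.1 w) (etrans (esym lE) lz)).
have [_ ind hull _] := hL.
have esupp (e : W -> R) : \sum_(w in supp e) e w = \sum_w e w.
  rewrite [RHS](bigID (mem (supp e))) /= [X in _ + X]big1 ?addr0 // => w.
  by rewrite inE negbK => /eqP.
pose x := l^-1 *: \sum_w b w *: p w.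
have inhull (e : W -> R) : in_cone L e -> \sum_w e w = l ->
    \sum_w e w *: p w = \sum_w b w *: p w -> convex_hull p (supp e) x.
  move=> [e0 eL] el eE; exists (fun w => l^-1 * e w); split.
  - by move=> w; rewrite mulr_ge0 ?invr_ge0.
  - by rewrite -mulr_sumr esupp el mulVf.
  - rewrite /x -eE (@sum_supp _ _ _ _ _ (supp e)) // scaler_sumr.
    by apply: eq_bigr => w _; rewrite scalerA.
have : (convex_hull p (supp b) `&` convex_hull p (supp b'))%classic x.
  by split; apply: inhull.
rewrite hull; [|by case: cb|by case: cb'] => -[a [a0 a1 xE]].
pose d w := if w \in supp b :&: supp b' then a w else 0.
have key (e : W -> R) : in_cone L e -> \sum_w e w = l ->
    \sum_w e w *: p w = \sum_w b w *: p w ->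
    supp b :&: supp b' \subset supp e -> forall w, e w = l * d w.
  move=> ce el eE sube w; have [e0 eL] := ce.
  have sd : supp d \subset supp e.
    apply: subset_trans sube; apply/subsetP => v; rewrite [v \in supp d]inE /d.
    by case: ifP; rewrite ?eqxx.
  case: (boolP (w \in supp e)) => we; last first.
    rewrite /d ifN; last by apply: contra we; apply: (subsetP sube).
    by rewrite mulr0; apply/eqP; rewrite inE negbK in we.
  apply/eqP; rewrite -subr_eq0; apply/eqP.
  have dsum (V : lmodType R) (f : W -> V) :
      \sum_(v in supp e) d v *: f v = \sum_(v in supp b :&: supp b') a v *: f v.
    rewrite [LHS]big_mkcond [RHS]big_mkcond /=; apply: eq_bigr => v _.
    rewrite /d; case: (boolP (v \in supp b :&: supp b')) => [/(subsetP sube) ->//|_].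
    by rewrite scale0r; case: ifP.
  apply: (ind _ eL (fun v => e v - l * d v)) we.
    have dl : \sum_(v in supp e) d v = 1.
      rewrite -a1 -[LHS]mulr1 -[RHS]mulr1 !mulr_suml; exact: (dsum R^o (fun=> 1)).
    by rewrite sumrB -mulr_sumr dl esupp el mulr1 subrr.
  rewrite (eq_bigr (fun v => e v *: p v - l *: (d v *: p v))); last first.
    by move=> v _; rewrite scalerBl scalerA.
  rewrite sumrB -scaler_sumr dsum -xE -(@sum_supp _ _ _ _ _ (supp e)) // eE.
  by rewrite /x scalerA divff ?scale1r ?subrr.
move=> w; rewrite (key b) ?subsetIl // [RHS](key b') ?subsetIr //.
Qed.

Lemma vertex_inj : {in vertices L &, injective p}.
Proof.
move=> w w'; rewrite !inE => wL w'L ww'.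
have sd v : supp (fun u => (u == v)%:R : R) = [set v].
  by apply/setP => u; rewrite !inE pnatr_eq0 eqb0 negbK.
have sp v : \sum_u (u == v)%:R *: p u = p v.
  rewrite (bigD1 v) //= eqxx scale1r big1 ?addr0 // => u /negPf ->.
  by rewrite scale0r.
have /(_ w) : (fun u => (u == w)%:R : R) =1 (fun u => (u == w')%:R).
  by apply: simplex_cone_unique; rewrite /in_cone ?sd ?sp.
by rewrite eqxx; case: eqP => // _ /eqP; rewrite oner_eq0.
Qed.

(** The coordinate is a sum of nonnegative terms. Thus a vector in a coordinate hyperplane is
    carried by vertices in that hyperplane. *)
Lemma supp_coord0 (b : W -> R) w i : in_cone L b ->
  (\sum_u b u *: p u) 0 i = 0 -> w \in supp b -> p w 0 i = 0.
Proof.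
move=> [b0 bL]; rewrite summxE => h; rewrite inE => bw.
have ge0 u : true -> 0 <= (b u *: p u) 0 i.
  rewrite mxE; have [->|/(supp_vertices Lsimp bL) uL _] := eqVneq (b u) 0; first by rewrite mul0r.
  by rewrite mulr_ge0 // vertex_ge0.
by have /eqP := psumr_eq0P ge0 h (i := w) isT; rewrite mxE mulf_eq0 (negPf bw) => /eqP.
Qed.

Lemma exists_corner i : exists2 w, w \in vertices L & p w = delta_mx 0 i.
Proof.
have [|b cb bE] := @simplex_cone_exists (delta_mx 0 i).
  by move=> j; rewrite mxE ler0n.
have [w bw] : exists w, b w != 0.
  apply: contrapT => h; move/rowP/(_ i)/eqP: bE; rewrite big1 => [|w _].
    by rewrite !mxE !eqxx eq_sym oner_eq0.
  have [->|bw] := eqVneq (b w) 0; first by rewrite scale0r.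
  by case: h; exists w.
have wL := supp_vertices Lsimp cb.2 bw; exists w => //.
have p0 j : j != i -> p w 0 j = 0.
  move=> ji; apply: (supp_coord0 cb); last by rewrite inE.
  by rewrite bE mxE eqxx (negPf ji).
apply/rowP => j; rewrite mxE eqxx /=; case: eqVneq => [->|/p0 //].
by have := vertex_sum wL; rewrite (bigD1 i) //= big1 ?addr0.
Qed.

Definition corner (i : 'I_k.+1) : W := projT1 (cid2 (exists_corner i)).

Lemma corner_vertex i : corner i \in vertices L.
Proof. by rewrite /corner; case: cid2. Qed.

Lemma corner_position i : p (corner i) = delta_mx 0 i.
Proof. by rewrite /corner; case: cid2. Qed.

Lemma corner_inj : injective corner.
Proof.
move=> i j /(congr1 p); rewrite !corner_position => /rowP/(_ i).
by rewrite !mxE !eqxx /=; case: eqP => // _ /eqP; rewrite oner_eq0.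
Qed.

Lemma boundary_vertex_corner w : w \in vertices L -> std_boundary (p w) ->
  exists i, w = corner i.
Proof.
move=> wL /(hbd wL)[i pw]; exists i; apply: vertex_inj => //.
  exact: corner_vertex.
by rewrite corner_position.
Qed.

Lemma vertices_boundary : vertices (boundary L p) = [set corner i | i : 'I_k.+1].
Proof.
apply/setP => w; rewrite inE /boundary inE; apply/andP/imsetP.
  case=> wL /asboolP bw; have wV : w \in vertices L by rewrite inE.
  have [|i ->] := boundary_vertex_corner wV.
    by apply: bw; exists (fun=> 1); split=> //; rewrite big_set1 ?scale1r.
  by exists i.
case=> i _ ->; split; first by have := corner_vertex i; rewrite inE.
apply/asboolP => x [a [_]]; rewrite !big_set1 => a1 ->; rewrite a1 scale1r.
split; first by apply/vertex_in_simplex/corner_vertex.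
(* This is where [k] being positive matters: a second index gives the corner a zero coordinate. *)
have [j ji] : exists j, j != i.
  by exists (lift i (Ordinal hk)); rewrite eq_sym neq_lift.
by exists j; rewrite corner_position mxE eqxx (negPf ji).
Qed.

(** The indicator vector of [I] has a zero coordinate, so the face of [L] carrying it has only
    boundary vertices. These are corners indexed by [I], and every index in [I] is needed to make
    its coordinate nonzero. *)
Lemma proper_face (I : {set 'I_k.+1}) : I != setT -> corner @: I \in L.
Proof.
rewrite -subTset => /subsetPn[j _ jI].
have zE i : (\row_l (l \in I)%:R : 'rV[R]_k.+1) 0 i = (i \in I)%:R by rewrite mxE.
have [|b cb bE] := @simplex_cone_exists (\row_l (l \in I)%:R).
  by move=> i; rewrite zE ler0n.
have p0 w i : w \in supp b -> i \notin I -> p w 0 i = 0.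
  by move=> wb iI; apply: (supp_coord0 cb); rewrite // bE zE (negPf iI).
have cornerb w : w \in supp b -> exists2 i, i \in I & w = corner i.
  move=> wb; have wL : w \in vertices L by apply: supp_vertices Lsimp cb.2 _; rewrite inE in wb.
  have [|i wi] := boundary_vertex_corner wL.
    by split; [exact: vertex_in_simplex | exists j; apply: p0].
  exists i => //; apply: contraT => /(p0 _ _ wb); rewrite wi corner_position mxE !eqxx.
  by move/eqP; rewrite oner_eq0.
suff <- : supp b = corner @: I by case: cb.
apply/setP => w; apply/idP/imsetP => [/cornerb [i iI ->]|[i iI ->]]; first by exists i.
have [w' bw' pw'] : exists2 w', w' \in supp b & p w' 0 i != 0.
  apply: contrapT => h; have /eqP := zE i; rewrite iI -bE summxE big1.
    by rewrite eq_sym oner_eq0.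
  move=> u _; rewrite mxE; have [->|bu] := eqVneq (b u) 0; first by rewrite mul0r.
  have [->|pu] := eqVneq (p u 0 i) 0; first by rewrite mulr0.
  by case: h; exists u; rewrite ?inE.
have [l lI wl] := cornerb _ bw'.
suff -> : i = l by rewrite -wl.
by move: pw'; rewrite wl corner_position mxE eqxx /=; case: (eqVneq i l) => [->|_] //; rewrite eqxx.
Qed.

End TriangulatedSimplex.

(** * Gluing a triangulated simplex into a fan *)
Section ReplaceFace.
Variables (W T : finType) (L : {set {set W}}) (K : {set {set T}}).
Variables (s : {set T}) (c : W -> T).
Hypotheses (Lsimp : simplicial_complex L) (Ksimp : simplicial_complex K).

Lemma replace_faceP u : reflect
  ((u \in K /\ ~~ (s \subset u)) \/
   exists s' t, [/\ s' \in L, t \in link K s & u = (c @: s') :|: t])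
  (u \in replace_face L K s c).
Proof.
have imP : (u \in [set s :|: t | t : {set T} in link K s]) = (u \in K) && (s \subset u).
  apply/imsetP/andP => [[t]|[uK su]].
    by rewrite inE => /and3P[_ _ stK] ->; rewrite subsetUl.
  have suE : s :|: (u :\: s) = u by rewrite -[RHS](setID u s) (setIidPr su).
  exists (u :\: s); last by [].
  rewrite inE suE uK (Ksimp.2 _ _ uK (subsetDl _ _)) andbT -setI_eq0.
  by apply/eqP/setP => x; rewrite !inE; case: (x \in s); rewrite ?andbF.
rewrite inE inE imP; apply: (iffP orP) => -[].
- by rewrite negb_and; case/andP=> /orP[/negPf->//|h uK]; left.
- by case/imset2P => s' t s'L tK ->; right; exists s', t.
- by case=> uK su; left; rewrite negb_and su orbT.
- by case=> s' [t [s'L tK ->]]; right; apply/imset2P; exists s' t.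
Qed.

Lemma link_sub (t t' : {set T}) : t \in link K s -> t' \subset t -> t' \in link K s.
Proof.
rewrite !inE => /and3P[tK dst stK] tt'; apply/and3P; split.
- exact: Ksimp.2 tK tt'.
- exact: disjointWr tt' dst.
- exact: Ksimp.2 stK (setUS _ tt').
Qed.

Lemma simplicial_replace_face :
  s != set0 -> simplicial_complex (replace_face L K s c).
Proof.
move=> s0; split.
  by apply/replace_faceP; left; rewrite Ksimp.1 subset0.
move=> u v /replace_faceP[[uK su] vu|[s' [t [s'L tK ->]]] vu]; apply/replace_faceP.
  left; split; first exact: Ksimp.2 vu.
  by apply: contra su => sv; apply: subset_trans vu.
right; exists (s' :&: c @^-1: v), (t :&: v); split.
- exact: Lsimp.2 s'L (subsetIl _ _).
- exact: link_sub tK (subsetIl _ _).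
apply/setP => x; apply/idP/setUP => [xv|[/imsetP[w + ->]|]]; last by rewrite inE => /andP[].
  have := subsetP vu x xv; rewrite inE => /orP[/imsetP[w ws xw]|xt].
    by left; apply/imsetP; exists w; rewrite // !inE ws -xw.
  by right; rewrite inE xt.
by rewrite !inE => /andP[].
Qed.

End ReplaceFace.

Section GluingFans.
Variables (R : realType) (k m : nat) (W T : finType).
Variables (L : {set {set W}}) (p : W -> 'rV[R]_k.+1).
Hypotheses (hk : (1 <= k)%N) (hL : triangulation L p).
Hypothesis hbd : no_new_boundary_vertices L p.
Variables (K : {set {set T}}) (q : T -> 'rV[R]_m) (s : {set T}) (c : W -> T).
Hypothesis fK : complete_fan K q.
Hypothesis gl : gluing_map L (boundary L p) K s c.

Let Lsimp : simplicial_complex L. Proof. by case: hL. Qed.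
Let Ksimp : simplicial_complex K. Proof. by case: fK. Qed.

Let beta (i : 'I_k.+1) : T := c (corner hL i).
Let newT : {set T} := [set c w | w in vertices L].

Let c_inj : {in vertices L &, injective c}. Proof. by case: gl. Qed.

Let cV w : w \in vertices L -> c w \in newT.
Proof. by move=> wL; apply/imsetP; exists w. Qed.

Let betaV i : beta i \in newT.
Proof. exact/cV/corner_vertex. Qed.

Let beta_inj : injective beta.
Proof.
by move=> i j /c_inj h; apply: (@corner_inj _ _ _ _ _ hL); apply: h; apply: corner_vertex.
Qed.

Let sE : s = [set beta i | i : 'I_k.+1].
Proof. by case: gl => _ <- _; rewrite (vertices_boundary hk hL hbd) -imset_comp. Qed.

Let betas i : beta i \in s.
Proof. by rewrite sE imset_f. Qed.

Let old_corner w : w \in vertices L -> c w \in vertices K -> exists i, w = corner hL i.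
Proof.
move=> wL cwK; case: gl => _ _ /(_ w wL).
rewrite (vertices_boundary hk hL hbd); case: imsetP => [[i _ ->]|_ /(_ isT)].
  by exists i.
by rewrite cwK.
Qed.

Let old_beta x : x \in newT -> x \in vertices K -> exists i, x = beta i.
Proof. by case/imsetP => w wL -> /(old_corner wL)[i ->]; exists i. Qed.

(** The image of [p w] under the linear map carrying the standard simplex onto the one spanned by
    [s]. Corners keep their old position; an interior vertex overrides whatever [q] gave its
    name. *)
Definition glued_position (x : T) : 'rV[R]_m :=
  if [pick w in vertices L | c w == x] is Some w
  then \sum_i p w 0 i *: q (c (corner hL i)) else q x.

Let posc w : w \in vertices L -> glued_position (c w) = \sum_i p w 0 i *: q (beta i).
Proof.
move=> wL; rewrite /glued_position; case: pickP => [w' /andP[w'L /eqP]|/(_ w)].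
  by move=> /c_inj ->.
by rewrite wL eqxx.
Qed.

Let pos_old x : x \notin newT -> glued_position x = q x.
Proof.
move=> xN; rewrite /glued_position; case: pickP => // w /andP[wL /eqP cw].
by rewrite -cw cV in xN.
Qed.

(* [a] lives on the glued complex, [e] on [K]; [b] is the part of [a] carried by
   the copy of [L], and [e] is its position within the cone over [s]. *)
Definition glue_related (a e : T -> R) (b : W -> R) : Prop :=
  [/\ forall w, w \in vertices L -> a (c w) = b w,
      forall w, w \notin vertices L -> b w = 0,
      forall x, x \notin newT -> a x = e x,
      forall i, e (beta i) = (\sum_w b w *: p w) 0 i
    & forall x, x \in newT -> x \notin s -> e x = 0].

Lemma glue_related_sum a e b : glue_related a e b ->
  \sum_x a x *: glued_position x = \sum_x e x *: q x.
Proof.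
case=> ab b0 ae ep e0.
rewrite [LHS](bigID (mem newT)) [RHS](bigID (mem newT)) /=; congr (_ + _); last first.
  by apply: eq_bigr => x xN; rewrite pos_old ?ae.
rewrite big_imset //=.
transitivity (\sum_(x in s) e x *: q x); last first.
  rewrite [LHS]big_mkcond [RHS]big_mkcond /=; apply: eq_bigr => x _.
  case: (boolP (x \in s)) => [|xs].
    by rewrite sE => /imsetP[i _ ->]; rewrite betaV.
  by case: ifP => // xN; rewrite e0 ?scale0r.
rewrite sE big_imset /=; last by move=> i j _ _; apply: beta_inj.
rewrite (eq_bigr (fun w => \sum_i (b w * p w 0 i) *: q (beta i))); last first.
  move=> w wL; rewrite posc // ab // scaler_sumr; apply: eq_bigr => i _.
  by rewrite scalerA.
rewrite exchange_big /=; apply: eq_bigr => i _.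
rewrite ep summxE -scaler_suml; congr (_ *: _); rewrite [LHS]big_mkcond /=.
by apply: eq_bigr => w _; rewrite mxE; case: ifP => // /negbT /b0 ->; rewrite mul0r.
Qed.

(** A face of [K] not containing [s] meets the copy of [L] in a proper subset of the corners, which
    is a face of [L] by [proper_face]. *)
Lemma glue_related_old a : in_cone K a -> ~~ (s \subset supp a) ->
  exists2 b, in_cone L b & glue_related a a b.
Proof.
move=> [a0 aK] sa; pose b w := if w \in vertices L then a (c w) else 0.
have aV x : a x != 0 -> x \in vertices K by apply: supp_vertices.
have bcorner w : b w != 0 -> exists i, w = corner hL i.
  by rewrite /b; case: ifP => [wL /aV|]; [apply: old_corner | rewrite eqxx].
exists b; last first.
  split=> //.
  - by move=> w wL; rewrite /b wL.
  - by move=> w /negPf wL; rewrite /b wL.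
  - move=> i; rewrite summxE (bigD1 (corner hL i)) //= big1 => [|w wi].
      by rewrite mxE corner_position mxE !eqxx mulr1 addr0 /b corner_vertex.
    rewrite mxE; have [->|/bcorner[j wj]] := eqVneq (b w) 0; first by rewrite mul0r.
    rewrite wj corner_position mxE eqxx /=; case: eqVneq => [ij|]; last by rewrite mulr0.
    by rewrite wj ij eqxx in wi.
  - move=> x xN xs; apply/eqP; apply: contraTT xs => /aV /(old_beta xN)[i ->].
    by rewrite negbK.
split; first by move=> w; rewrite /b; case: ifP.
pose I := [set i | a (beta i) != 0].
have IT : I != setT.
  apply: contra sa => /eqP IT; apply/subsetP => x; rewrite sE => /imsetP[i _ ->].
  by have := in_setT i; rewrite -IT !inE.
suff -> : supp b = corner hL @: I by apply: proper_face.
apply/setP => w; apply/idP/imsetP => [|[i]].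
  rewrite inE => bw; have [i wi] := bcorner _ bw; exists i => //.
  by move: bw; rewrite wi /b corner_vertex inE.
by rewrite !inE /b => ai ->; rewrite corner_vertex.
Qed.

(** The part of [a] on the copy of [L] is collapsed to its point [z] and redistributed over the
    corners. For a new face, disjointness of [t] and [s] keeps this part inside [s'], and the
    collapsed vector is supported in the old face [s :|: t]. *)
Lemma glue_related_new a : in_cone (replace_face L K s c) a ->
  exists e b, [/\ in_cone K e, in_cone L b & glue_related a e b].
Proof.
move=> [a0 /(replace_faceP L s c Ksimp)[[aK sa]|[s' [t [s'L tK aE]]]]].
  have [|b cb r] := @glue_related_old a _ sa; first by split.
  by exists a, b.
have [tt dst stK] : [/\ t \in K, [disjoint s & t] & s :|: t \in K].
  by move: tK; rewrite inE => /and3P[].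
pose b w := if w \in vertices L then a (c w) else 0.
have b0 w : 0 <= b w by rewrite /b; case: ifP.
have cb : in_cone L b.
  split=> //; apply: (Lsimp.2 _ _ s'L); apply/subsetP => w; rewrite inE /b.
  case: ifP => [wL acw|]; last by rewrite eqxx.
  have : c w \in supp a by rewrite inE.
  rewrite aE inE => /orP[/imsetP[w' w's' /c_inj->]//|cwt].
    by rewrite inE; apply: (Lsimp.2 _ _ s'L); rewrite sub1set.
  have [|i wi] := @old_corner w wL.
    by rewrite inE; apply: (Ksimp.2 _ _ tt); rewrite sub1set.
  by have := disjointFr dst (betas i); rewrite /beta -wi cwt.
pose z := \sum_w b w *: p w.
have z0 i : 0 <= z 0 i.
  rewrite summxE; apply: sumr_ge0 => w _; rewrite mxE.
  have [->|/(supp_vertices Lsimp cb.2) wL] := eqVneq (b w) 0; first by rewrite mul0r.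
  by rewrite mulr_ge0 // (vertex_ge0 hL).
pose e x := if x \in newT then \sum_(i | beta i == x) z 0 i else a x.
have eb i : e (beta i) = z 0 i.
  by rewrite /e betaV (big_pred1 i) // => j; rewrite /= (inj_eq beta_inj).
have e0 x : x \in newT -> x \notin s -> e x = 0.
  move=> xN xs; rewrite /e xN big1 // => i /eqP ix.
  by rewrite -ix betas in xs.
exists e, b; split=> //; last first.
  split=> //.
  - by move=> w wL; rewrite /b wL.
  - by move=> w /negPf wL; rewrite /b wL.
  - by move=> x /negPf xN; rewrite /e xN.
split; first by move=> x; rewrite /e; case: ifP => // _; apply: sumr_ge0.
apply: (Ksimp.2 _ _ stK); apply/subsetP => x; rewrite !inE.
case: (boolP (x \in s)) => //= xs; case: (boolP (x \in newT)) => xN.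
  by rewrite e0 ?eqxx.
rewrite /e (negPf xN) => ax; have : x \in supp a by rewrite inE.
rewrite aE inE => /orP[/imsetP[w ws' xw]|//].
by rewrite xw cV // inE in xN; apply: (Lsimp.2 _ _ s'L); rewrite sub1set.
Qed.

(** Related vectors represent the same point. Existence therefore comes from subdividing the part
    over [s] through [L], and uniqueness from comparing first the vectors on [K] and then those on
    [L]. *)
Lemma fan_replace_face : complete_fan (replace_face L K s c) glued_position.
Proof.
have [_ ex uni] := fK; split.
- apply: simplicial_replace_face => //.
  by apply/set0Pn; exists (beta ord0).
- move=> y; have [e [e0 eK] <-] := ex y.
  case: (boolP (s \subset supp e)) => se; last first.
    have [b _ r] := glue_related_old (conj e0 eK) se.
    exists e; last exact: glue_related_sum r.
    by split=> //; apply/replace_faceP => //; left.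
  have [|b cb bE] := @simplex_cone_exists _ _ _ _ _ hL (\row_i e (beta i)).
    by move=> i; rewrite mxE.
  (* The coefficients on [s] are replaced by their representation through [L]; names outside the
     copy keep [e]. *)
  pose a x := if [pick w in vertices L | c w == x] is Some w then b w else e x.
  have ac w : w \in vertices L -> a (c w) = b w.
    move=> wL; rewrite /a; case: pickP => [w' /andP[w'L /eqP /c_inj -> //]|/(_ w)].
    by rewrite wL eqxx.
  have aold x : x \notin newT -> a x = e x.
    move=> xN; rewrite /a; case: pickP => // w /andP[wL /eqP cw].
    by rewrite -cw cV in xN.
  have r : glue_related a e b.
    split=> //.
    - by move=> w wL; apply/eqP; apply: contraR wL => /(supp_vertices Lsimp cb.2).
    - by move=> i; rewrite bE mxE.
    - move=> x xN xs; apply/eqP; apply: contraTT xs => /(supp_vertices Ksimp eK).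
      by case/(old_beta xN) => i ->; rewrite negbK.
  exists a; last exact: glue_related_sum r.
  split.
    by move=> x; rewrite /a; case: pickP => [w _|_] //; case: cb.
  apply/replace_faceP => //; right; exists (supp b), (supp e :\: s).
  split; first by case: cb.
    rewrite inE (Ksimp.2 _ _ eK (subsetDl _ _)) /=.
    have -> : s :|: supp e :\: s = supp e by rewrite -[RHS](setID _ s) (setIidPr se).
    rewrite eK andbT -setI_eq0.
    by apply/eqP/setP => x; rewrite !inE; case: (x \in s); rewrite ?andbF.
  apply/setP => x; case: (boolP (x \in newT)) => [/imsetP[w wL ->]|xN].
    rewrite !inE ac //; apply/idP/orP => [bw|[/imsetP[w' bw']|/andP[ns ecw]]].
    - by left; apply/imsetP; exists w; rewrite ?inE.
    - move=> /c_inj ->//; first by rewrite inE in bw'.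
      by apply: (supp_vertices Lsimp cb.2); rewrite inE in bw'.
    - have [i wi] := old_corner wL (supp_vertices Ksimp eK ecw).
      by rewrite wi betas in ns.
  rewrite !inE aold //; apply/idP/orP => [ex0|[/imsetP[w bw xw]|/andP[]//]].
    right; rewrite ex0 andbT; apply: contra xN; rewrite sE => /imsetP[i _ ->].
    exact: betaV.
  rewrite xw cV // in xN.
  by apply: (supp_vertices Lsimp cb.2); rewrite inE in bw.
move=> a a' ca ca'.
have [e [b [ce cb r]]] := glue_related_new ca.
have [e' [b' [ce' cb' r']]] := glue_related_new ca'.
rewrite (glue_related_sum r) (glue_related_sum r') => /(uni _ _ ce ce') ee'.
have [ab _ ae eb _] := r; have [ab' _ ae' eb' _] := r'.
have bb' : b =1 b'.
  apply: (simplex_cone_unique hL) => //; apply/rowP => i.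
  by rewrite -eb -eb' ee'.
move=> x; case: (boolP (x \in newT)) => [/imsetP[w wL ->]|xN].
  by rewrite ab // ab' // bb'.
by rewrite ae // ae' // ee'.
Qed.

End GluingFans.

(** * Existence of a generalized Tchebyshev triangulation carrying a complete fan *)

Section ExistenceOfTriangulations.
Variables (R : realType) (k m N : nat) (W : finType).
Variables (L : {set {set W}}) (p : W -> 'rV[R]_k.+1).
Hypotheses (hk : (1 <= k)%N) (hL : triangulation L p).
Hypothesis hbd : no_new_boundary_vertices L p.
Let T : finType := ('I_m * bool + 'I_N * W)%type.

Let Lsimp : simplicial_complex L. Proof. by case: hL. Qed.

(* The interior vertices of a new copy of [L] all receive the tag [i]. *)
Lemma exists_gluing_map (K : {set {set T}}) (s : {set T}) (i : 'I_N) :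
  simplicial_complex K -> s \in K -> #|s| = k.+1 ->
  (forall w, inr (i, w) \notin vertices K) ->
  exists2 c : W -> T, gluing_map L (boundary L p) K s c
    & forall w, c w \in s \/ c w = inr (i, w).
Proof.
move=> [_ Kd] sK sk fresh.
have svK x : x \in s -> x \in vertices K.
  by move=> xs; rewrite inE; apply: (Kd _ _ sK); rewrite sub1set.
have ssz (l : 'I_k.+1) : (l < size (enum s))%N by rewrite -cardE sk.
pose c w : T := if [pick l | corner hL l == w] is Some l
                then nth (inr (i, w)) (enum s) l else inr (i, w).
have cc l x0 : c (corner hL l) = nth x0 (enum s) l.
  rewrite /c; case: pickP => [l' /eqP/corner_inj ->|/(_ l)]; last by rewrite eqxx.
  exact: set_nth_default.
have cs l : c (corner hL l) \in s.
  by rewrite (cc l (inr (i, corner hL l))) -mem_enum mem_nth.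
have cn w : (forall l, w <> corner hL l) -> c w = inr (i, w).
  by move=> h; rewrite /c; case: pickP => // l /eqP e; case: (h l).
have cdec w : (exists l, w = corner hL l) \/ (forall l, w <> corner hL l).
  by case: (pselect (exists l, w = corner hL l)) => h; [left|right=> l e; apply: h; exists l].
exists c; last first.
  by move=> w; have [[l ->]|/cn] := cdec w; [left|right].
split.
- move=> w w' _ _; have [[l ->]|wn] := cdec w; have [[l' ->]|wn'] := cdec w'.
  + rewrite (cc l (inr (i, w))) (cc l' (inr (i, w))) => /eqP.
    by rewrite nth_uniq ?enum_uniq // => /eqP/val_inj ->.
  + rewrite [c w']cn // => e; have := fresh w'.
    by rewrite -e svK.
  + rewrite [c w]cn // => e; have := fresh w.
    by rewrite e svK.
  + by rewrite !cn // => -[].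
- rewrite (vertices_boundary hk hL hbd) -imset_comp; apply/setP => x.
  apply/imsetP/idP => [[l _ ->]|xs]; first exact: cs.
  have lx : (index x (enum s) < k.+1)%N by rewrite -sk cardE index_mem mem_enum.
  by exists (Ordinal lx); rewrite //= (cc _ x) /= nth_index // mem_enum.
- move=> w wL; rewrite (vertices_boundary hk hL hbd) => wn; rewrite cn ?fresh //.
  by move=> l wl; rewrite wl imset_f in wn.
Qed.

(** Induction on the faces still to be replaced. Tags in use are at least the length of the
    remaining list, so the length of its tail is a fresh tag for the next copy and the invariant
    persists. *)
Lemma exists_replace_faces (r : seq {set T}) (K : {set {set T}}) (q : T -> 'rV[R]_m) :
  complete_fan K q -> uniq r ->
  (forall s, s \in r -> s \in K /\ #|s| = k.+1) ->
  (size r <= N)%N ->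
  (forall i w, inr (i, w) \in vertices K -> (size r <= i)%N) ->
  exists K' (q' : T -> 'rV[R]_m), [/\ replace_faces L (boundary L p) K r K', complete_fan K' q'
    & forall u : {set T}, u \in K -> (#|u| <= k)%N -> u \in K'].
Proof.
elim: r K q => [|s r IHr] K q fK; first by exists K, q.
move=> /= /andP[sr ur] rK rN fresh.
have Ksimp : simplicial_complex K by case: fK.
have [sK sk] := rK s (mem_head _ _).
have [|c gl cE] := @exists_gluing_map K s (Ordinal rN) Ksimp sK sk.
  by move=> w; apply/negP => /fresh /=; rewrite ltnn.
have fK1 := fan_replace_face hk hL hbd fK gl.
(* A set with at most [k.+1] elements contains [s] only if it equals [s]; hence the listed faces
   still to come and all smaller faces survive. *)
have keep (u : {set T}) : u \in K -> (#|u| <= k.+1)%N -> u != s -> u \in replace_face L K s c.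
  move=> uK uk us; apply/replace_faceP => //; left; split=> //.
  by apply: contra us => su; rewrite eq_sym eqEcard su sk.
have [|||K' [q' [rK' fK' keep']]] := IHr _ _ fK1 ur.
- move=> u uir; have [|uK uk] := rK u; first by rewrite inE uir orbT.
  by split=> //; apply: keep; rewrite ?uk //; apply: contraNneq sr => <-.
- exact: ltnW.
- move=> i w; rewrite inE => /(replace_faceP L s c Ksimp)[[iK _]|[s' [t [_ tK E]]]].
    by apply/ltnW/(fresh i w); rewrite inE.
  have : inr (i, w) \in [set c x | x in s'] :|: t by rewrite -E set11.
  rewrite inE => /orP[/imsetP[w' _ e]|it]; last first.
    apply/ltnW/(fresh i w); rewrite inE; apply: (Ksimp.2 t); rewrite ?sub1set //.
    by move: tK; rewrite inE => /andP[].
  have [cs|] := cE w'; last by rewrite -e => -[-> _] /=.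
  by apply/ltnW/(fresh i w); rewrite inE; apply: (Ksimp.2 s); rewrite ?sub1set // e.
exists K', q'; split=> //; first by exists c.
move=> u uK uk; apply: (keep' _ _ uk); apply: keep => //; first exact: leqW.
by apply: contraTneq uk => ->; rewrite sk ltnn.
Qed.

End ExistenceOfTriangulations.

Lemma exists_tchebyshev_fan (R : realType) (k m : nat) (W : finType)
    (L : {set {set W}}) (p : W -> 'rV[R]_k.+1) :
  (1 <= k)%N -> triangulation L p -> no_new_boundary_vertices L p ->
  exists (C : finType) (K' : {set {set ('I_m * bool + C)}}) q,
    [/\ tchebyshev_triangulation k L (boundary L p) (cross_polytope m C) K',
        complete_fan K' (q : _ -> 'rV[R]_m)
      & forall u, u \in cross_polytope m C -> (#|u| <= k)%N -> u \in K'].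
Proof.
(* [N] bounds the number of copies to be glued, since each replaced face is a set of signed
   coordinates. *)
move=> hk hL hbd; pose N := #|{set 'I_m * bool}|; pose C : finType := ('I_N * W)%type.
pose K := cross_polytope m C.
pose r := enum [set s in K | #|s| == k.+1].
have rP s : (s \in r) = (s \in K) && (#|s| == k.+1) by rewrite mem_enum inE.
have rN : (size r <= N)%N.
  rewrite -cardE; pose F (v : {set 'I_m * bool}) : {set 'I_m * bool + C} := inl @: v.
  apply: leq_trans (leq_imset_card F predT); apply: subset_leq_card.
  apply/subsetP => s; rewrite inE => /andP[/cross_polytopeP[s1 _] _].
  apply/imsetP; exists (inl @^-1: s) => //; apply/setP => -[x|z].
    by rewrite mem_imset ?inE // => ? ? [].
  by rewrite (negPf (s1 z)); apply/esym/imsetP => -[].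
have [||||K' [q [rK' fK' keep]]] :=
  @exists_replace_faces R k m N W L p hk hL hbd r K _ (fan_cross_polytope R m C).
- exact: enum_uniq.
- by move=> s; rewrite rP => /andP[-> /eqP].
- exact: rN.
- by move=> i w; rewrite inE => /cross_polytopeP[/(_ (i, w))]; rewrite set11.
by exists C, K', q; split=> //; exists r; split=> //; apply: enum_uniq.
Qed.

(** * Degree, parity and real roots *)

Theorem theorem8p4 (R : realType) (k : nat) (hk : (1 <= k)%N)
    (W : finType) (L : {set {set W}}) (p : W -> 'rV[R]_k.+1)
    (hL : triangulation L p) (hbd : no_new_boundary_vertices L p)
    (j : nat) (hj : (2 <= j <= k.+1)%N)
    (U : {linear {poly R} -> {poly R}}) (hU : tchebyshev_map L p j U)
    (n : nat) :
  [/\ size (tchebyshev_poly j U n) = n.+1,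
      (-1) ^+ n *: (tchebyshev_poly j U n \Po (- 'X)) = tchebyshev_poly j U n
    & forall x : R, root (tchebyshev_poly j U n) x -> -1 <= x <= 1].
Proof.
have /andP[j2 jk] := hj.
pose m := (n + j - 1)%N.
have mn : (m - (j - 1))%N = n by rewrite /m; lia.
have [C [K' [q [tch fK' keep]]]] := exists_tchebyshev_fan m hk hL hbd.
pose K := cross_polytope m C.
pose F s := Fpoly R (link K' s).
have UE : U 'X^m = \sum_(s in K | #|s| == (j - 1)%N) F s.
  rewrite -(Fpoly_cross_polytope R m C).
  by rewrite (hU.2 _ _ _ (simplicial_cross_polytope m C) tch).
(* The bound [j <= k.+1] enters here: faces with [j - 1 <= k] elements survive all gluings, so their
   links in [K'] are links of faces. *)
have PK s : (s \in K) && (#|s| == (j - 1)%N) -> s \in K' /\ (m - #|s|)%N = n.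
  by case/andP=> sK /eqP sj; rewrite sj mn; split=> //; apply: keep => //; lia.
(* One such face makes the sum nonempty, as strict positivity of the leading coefficient and of the
   values beyond 1 requires. *)
have [s0 s0K s0j] : exists2 s, s \in K & #|s| = (j - 1)%N.
  by apply: exists_cross_polytope_face; rewrite /m; lia.
have s0P : (s0 \in K) && (#|s0| == (j - 1)%N) by rewrite s0K s0j eqxx.
pose a : R := (j - 1)`!%:R / 2 ^+ (j - 1).
have a0 : 0 < a by rewrite divr_gt0 ?exprn_gt0 ?ltr0n ?fact_gt0.
have tE : tchebyshev_poly j U n = a *: \sum_(s in K | #|s| == (j - 1)%N) F s.
  by rewrite /tchebyshev_poly UE.
have sym : (-1) ^+ n *: (tchebyshev_poly j U n \Po (- 'X)) = tchebyshev_poly j U n.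
  rewrite tE linearZ /= raddf_sum /= scalerA mulrC -scalerA scaler_sumr.
  congr (_ *: _); apply: eq_bigr => s /PK[sK' sn].
  by rewrite (link_fan_symmetric fK' sK') sn scalerA -exprD addnn -mul2n exprM sqrrN !expr1n scale1r.
have pos x : 1 < x -> 0 < (tchebyshev_poly j U n).[x].
  move=> x1; rewrite tE hornerZ mulr_gt0 // horner_sum (bigD1 s0) //= ltr_pwDl //.
    by have [sK' _] := PK _ s0P; apply: (link_fan_gt0 fK' sK').
  by apply: sumr_ge0 => s /andP[/PK[sK' _] _]; apply/ltW/(link_fan_gt0 fK' sK').
split=> //.
- rewrite tE size_scale ?gt_eqF //; apply/eqP; rewrite eqn_leq; apply/andP; split.
    apply: leq_trans (size_sum _ _ _) _; apply/bigmax_leqP => s /PK[sK' sn].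
    by have := size_link_fan fK' sK'; rewrite sn.
  rewrite ltnNge; apply/negP => /(nth_default 0) /eqP; rewrite coef_sum.
  rewrite gt_eqF // (bigD1 s0) //= ltr_pwDl //.
    by have [sK' sn] := PK _ s0P; have := coef_link_fan fK' sK'; rewrite sn.
  apply: sumr_ge0 => s /andP[/PK[sK' sn] _].
  by have := coef_link_fan fK' sK'; rewrite sn => /ltW.
(* A root below -1 is reflected by [sym] to a root above 1, contradicting [pos]. *)
move=> x rx; rewrite leNgt [x <= 1]leNgt -negb_or; apply/negP => /orP[xN|/pos].
  have /pos : 1 < - x by rewrite ltrNr.
  have := rx; rewrite -{1}sym rootZ ?expf_neq0 ?oppr_eq0 ?oner_eq0 //.
  by rewrite /root horner_comp hornerN hornerX => /eqP ->; rewrite ltxx.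
by rewrite (rootP rx) ltxx.
Qed.
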